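(* Let $A\in \mathrm{GL}(n,\mathbb{R})$ with $|\det A|>1$. Then the pair $(A,\Gamma)$ satisfies the lattice counting estimate for all full-rank lattices $\Gamma\subset\mathbb{R}^n$ if and only if $A$ is expanding on a subspace (that is, there exists a non-zero linear subspace $F\subset\mathbb{R}^n$ such that $A$ is expanding on $F$).
   Context: Lattice counting estimate: let $A$ be an invertible $n\times n$ real matrix with $|\det A|>1$ and $\Gamma\subset\mathbb{R}^n$ a full-rank lattice. The pair $(A,\Gamma)$ satisfies the lattice counting estimate if, for $r>0$, there is a constant $C=C(r)$ such that $$\#\big(\Gamma\cap A^j(\mathbf{B}(0,r))\big)\le C\max(1,|\det A|^j)\quad\text{for all } j\in\mathbb{Z},$$ where $\mathbf{B}(0,r)$ is the open ball of radius $r$ centered at $0$. The validity of this estimate for some $r>0$ is equivalent to its validity for every $r>0$ (with $C$ depending on $r$). Expanding on a subspace: given $A\in\mathrm{GL}(n,\mathbb{R})$ and a non-zero linear subspace $F\subset\mathbb{R}^n$, $A$ is expanding on $F$ if there exists a complementary (not necessarily orthogonal) linear subspace $E$ of $\mathbb{R}^n$ such that: (i) $\mathbb{R}^n=F+E$ and $F\cap E=\{0\}$; (ii) $A(F)=F$ and $A(E)=E$; (iii) there exist $c\ge 1$ and $\gamma>1$ such that for all $j\ge 0$, $|A^jx|\ge (1/c)\gamma^j|x|$ for all $x\in F$; (iv) there exists $k>0$ such that for all $j\ge0$, $|A^jx|\ge k|x|$ for all $x\in E$. Here $|\cdot|$ on $\mathbb{R}^n$ is the Euclidean norm. *)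

(* Defs.v *)
From HB Require Import structures.
From mathcomp Require Import all_boot all_order all_algebra.
From mathcomp Require Import all_classical all_reals.
From mathcomp Require Import ereal counting_measure.

Set Implicit Arguments.
Unset Strict Implicit.
Unset Printing Implicit Defensive.

Import Order.TTheory GRing.Theory Num.Theory.

Local Open Scope classical_set_scope.
Local Open Scope ring_scope.

(* The ambient space is 'cV[R]_n.+1, so that 'M[R]_n.+1 is a unit ring and the
   powers [A ^+ j] (j : nat) and [A ^ j] (j : int) are the library ones. *)

(* Euclidean norm; the library norm on matrices is the max norm. *)
Definition enorm (R : realType) (n : nat) (x : 'cV[R]_n) : R :=
  Num.sqrt (\sum_(i < n) x i 0 ^+ 2).

Definition eball (R : realType) (n : nat) (r : R) : set 'cV[R]_n :=
  [set x | enorm x < r].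

Definition full_rank_lattice (R : realType) (n : nat) (Gamma : set 'cV[R]_n) :
    Prop :=
  exists2 P : 'M[R]_n, P \in unitmx &
    Gamma = range (fun z : 'cV[int]_n => P *m map_mx intr z).

(* [counting] is +oo on infinite sets, so the bound includes finiteness. *)
Definition lattice_counting_estimate (R : realType) (n : nat)
    (A : 'M[R]_n.+1) (Gamma : set 'cV[R]_n.+1) : Prop :=
  forall r : R, 0 < r -> exists C : R, forall j : int,
    (counting (Gamma `&` [set A ^ j *m x | x in eball r])
       <= (C * Num.max 1 (`|\det A| ^ j))%:E)%E.

Definition expanding_on (R : realType) (n : nat)
    (A : 'M[R]_n.+1) (F : {vspace 'cV[R]_n.+1}) : Prop :=
  exists E : {vspace 'cV[R]_n.+1},
    [/\ (F + E = fullv)%VS /\ (F :&: E = 0)%VS,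
        (linfun (mulmx A) @: F = F)%VS /\ (linfun (mulmx A) @: E = E)%VS,
        exists c gamma : R, [/\ 1 <= c, 1 < gamma &
          forall (j : nat) (x : 'cV[R]_n.+1), x \in F ->
            c^-1 * gamma ^+ j * enorm x <= enorm (A ^+ j *m x)] &
        exists2 k : R, 0 < k &
          forall (j : nat) (x : 'cV[R]_n.+1), x \in E ->
            k * enorm x <= enorm (A ^+ j *m x)].

Definition expanding_on_subspace (R : realType) (n : nat) (A : 'M[R]_n.+1) :
    Prop :=
  exists2 F : {vspace 'cV[R]_n.+1}, F != 0%VS & expanding_on A F.

(* Main.v *)
Require Import Defs.
From HB Require Import structures.
From mathcomp Require Import all_boot all_order all_algebra finmap perm.
From mathcomp Require Import all_classical all_reals.
From mathcomp Require Import topology normedtype sequences ereal.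
From mathcomp Require Import counting_measure.
From mathcomp Require Import zify ring lra.

(** Both sides of the equivalence say that the negative powers of [A] are
uniformly bounded, that is, [|x| <= K * |A ^ j x|] for some [K] and all
[j >= 0] and [x] ([backward_bounded]).

If the negative powers are bounded, then counting the points of [P Z^n] in
[A ^ j B(0, r)] means counting the integer vectors [z] with [|M z| < r], where
[M = A ^ -j P]. For [j >= 0] the entries of [M] stay bounded, and elimination
with a pivot of maximal modulus bounds the count by a constant over [|det M|],
which is the constant times [|det A| ^ j] ([lattice_points_le]); for [j <= 0]
the set [A ^ j B(0, r)] lies in a fixed ball. This is
[backward_bounded_counting].

If they are unbounded, then the sets [A ^ -j B(0, r)] contain segments through
the origin of arbitrary length. Given any basis [P] of a lattice and a
direction [v], a lattice point at bounded distance from a remote point of the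
ray along [v] is moved onto the ray by a small change of [P]. So, for each [k],
the matrices [P] whose lattice has [k] points on one of these segments form a
dense set, and this set is open. By the Baire property one lattice has this
property for all [k], and its number of points in [A ^ -j B(0, r)] is unbounded
in [j], although [max(1, |det A| ^ -j) = 1]
([counting_backward_bounded]).

An expanding splitting bounds the negative powers because the two projections
are bounded ([expanding_backward_bounded]). Conversely, bounded powers of
[B = A ^ -1] have cluster points, which commute with [B] and are closed under
products. For a cluster point [L] of minimal rank, [L ^ 2] is again a cluster
point, so it has the rank of [L] and the space is the direct sum of [ker L] and
[im L]. Some power [B ^ J] is close to [L], hence contracts [ker L] by a factor
[1/2]: [A] expands on [F = ker L]. The determinants of the powers of [B] tend
to [0], so [L] is singular and [F] is non-zero
([backward_bounded_expanding]). *)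

Set Implicit Arguments.
Unset Strict Implicit.
Unset Printing Implicit Defensive.
Import Order.TTheory GRing.Theory Num.Theory.
Import numFieldNormedType.Exports.
Local Open Scope classical_set_scope.
Local Open Scope ring_scope.

(** * The maximum norm on matrices and the Euclidean norm *)

Section MatrixNorm.
Variable R : realType.

Lemma entry_le_norm m n (M : 'M[R]_(m, n)) i j : `|M i j| <= `|M|.
Proof.
rewrite [leRHS]mx_normrE.
exact: (le_bigmax _ (fun ij : 'I_m * 'I_n => `|M ij.1 ij.2|) (i, j)).
Qed.

Lemma norm_le_entries m n (M : 'M[R]_(m, n)) K :
  0 <= K -> (forall i j, `|M i j| <= K) -> `|M| <= K.
Proof.
by move=> K0 MK; rewrite [leLHS]mx_normrE; apply/bigmax_leP; split.
Qed.

Lemma norm_mulmx_le m n p (M : 'M[R]_(m, n)) (N : 'M[R]_(n, p)) :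
  `|M *m N| <= n%:R * `|M| * `|N|.
Proof.
apply: norm_le_entries => [|i j]; first by rewrite !mulr_ge0.
rewrite mxE (le_trans (ler_norm_sum _ _ _))//.
rewrite (le_trans (ler_sum _ (G := fun=> `|M| * `|N|) _))//.
  by move=> k _; rewrite normrM ler_pM ?entry_le_norm.
by rewrite sumr_const card_ord -[leLHS]mulr_natl mulrA.
Qed.

Lemma enorm_ge0 n (x : 'cV[R]_n) : 0 <= enorm x.
Proof. exact: sqrtr_ge0. Qed.

Lemma norm_le_enorm n (x : 'cV[R]_n) : `|x| <= enorm x.
Proof.
apply: norm_le_entries => [|i j]; first exact: enorm_ge0.
rewrite ord1 -sqrtr_sqr ler_wsqrtr// (bigD1 i)//= lerDl sumr_ge0// => k _.
exact: sqr_ge0.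
Qed.

Lemma enorm_le_norm n (x : 'cV[R]_n) : enorm x <= n%:R * `|x|.
Proof.
rewrite -[leRHS]ger0_norm ?mulr_ge0// -sqrtr_sqr ler_wsqrtr//.
rewrite (le_trans (ler_sum _ (G := fun=> `|x| ^+ 2) _))//.
  by move=> i _; rewrite -real_normK ?num_real// lerXn2r ?nnegrE ?entry_le_norm.
rewrite sumr_const card_ord -[leLHS]mulr_natl exprMn ler_wpM2r ?sqr_ge0//.
by rewrite -natrX ler_nat; case: n {x} => // n; rewrite leq_pmull.
Qed.

Lemma bernoulli_le (h : R) k : 0 <= 1 + h -> 1 + k%:R * h <= (1 + h) ^+ k.
Proof.
move=> h0; elim: k => [|k IH]; first by rewrite mul0r addr0 expr0.
rewrite exprSr (le_trans _ (ler_wpM2r h0 IH))//.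
have := sqr_ge0 h; have : 0 <= k%:R :> R by []; rewrite -natr1; nra.
Qed.

Lemma expr_unbounded (a b : R) : 1 < a ->
  exists N, forall j, (N <= j)%N -> b < a ^+ j.
Proof.
move=> a1; have h0 : 0 < a - 1 by rewrite subr_gt0.
exists (Num.bound `|b / (a - 1)|) => j jN.
rewrite -[a](subrK 1) [_ + 1]addrC.
apply: lt_le_trans (bernoulli_le _ _); last first.
  by rewrite addrC subrK ltW ?(lt_trans ltr01).
suff bj : b < j%:R * (a - 1) by rewrite (lt_trans bj)// ltrDr.
rewrite -ltr_pdivrMr// (le_lt_trans (ler_norm _))//.
by rewrite (lt_le_trans (archi_boundP _)) ?ler_nat.
Qed.
End MatrixNorm.

Lemma size_le_fibers (T S : eqType) (R : realType) (f : T -> S) (s : seq T)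
    (d : R) :
  (forall x, x \in s -> (count (fun y => f y == f x) s)%:R <= d) ->
  (size s)%:R <= (size (undup (map f s)))%:R * d.
Proof.
move=> sd.
rewrite -(size_map f) -(perm_size (perm_count_undup (map f s))).
rewrite size_flatten sumnE /shape !big_map natr_sum.
rewrite mulr_natl -count_predT -iter_addr_0 -big_const_seq.
rewrite big_seq [leRHS]big_seq.
apply: ler_sum => y; rewrite mem_undup => /mapP[x xs ->].
by rewrite size_nseq count_map; apply: sd.
Qed.

(** * Integer points in a linear preimage of a ball *)

Section Counting.
Variable R : realType.

Lemma lt_path_last (a : int) (s : seq int) :
  path <%R a s -> a + (size s)%:Z <= last a s.
Proof.
elim: s a => [|b s IH] a /=; first by rewrite addr0.
by case/andP => ab /IH; lia.
Qed.

(** The extreme elements of [s] differ by at least [size s - 1], while their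
images under [t |-> p t + c] differ by at most [2 r]. *)
Lemma size_int_interval_le (p c r : R) (s : seq int) : uniq s -> 0 <= r ->
  {in s, forall t, `|p * t%:~R + c| <= r} ->
  (size s)%:R * `|p| <= 2 * r + `|p|.
Proof.
move=> su r0 sr; rewrite -(size_sort <=%R s).
have : sorted <%R (sort <=%R s) by rewrite sort_lt_sorted.
have {sr} : {in sort <=%R s, forall t, `|p * t%:~R + c| <= r}.
  by move=> t; rewrite mem_sort; exact: sr.
case: (sort _ s) => [|a l] sr /=; first by rewrite mul0r addr_ge0 ?mulr_ge0.
move=> /lt_path_last al.
have sa := sr a (mem_head _ _); have sb := sr _ (mem_last a l).
rewrite -natr1 mulrDl mul1r lerD2r.
apply: le_trans (_ : `|(p * (last a l)%:~R + c) - (p * a%:~R + c)| <= _); last first.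
  by rewrite (le_trans (ler_normB _ _))//; lra.
rewrite opprD addrACA subrr addr0 -mulrBr -intrB normrM mulrC ler_wpM2l//.
rewrite (le_trans _ (ler_norm _))// -[X in X <= _]/((size l)%:Z%:~R) ler_int.
lia.
Qed.

Lemma schur_factor n (M : 'M[R]_(1 + n)) : M 0 0 != 0 ->
  M = block_mx 1%:M 0 ((M 0 0)^-1 *: dlsubmx M) 1%:M *m
      block_mx (M 0 0)%:M (ursubmx M) 0
        (drsubmx M - (M 0 0)^-1 *: (dlsubmx M *m ursubmx M)).
Proof.
move=> p0; rewrite mulmx_block !mul1mx !mul0mx !addr0.
rewrite mul_mx_scalar scalerA mulfV// scale1r -scalemxAl.
rewrite [X in block_mx _ _ _ X]addrC.
rewrite subrK -[LHS]submxK; congr block_mx.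
by apply/matrixP => i j; rewrite !ord1 !mxE !lshift0 eqxx mulr1n.
Qed.

(** The count is at most a constant over the covolume, the constant depending
on [M] only through a bound [K] on its entries. By induction on [n]: after a
permutation of the rows the entry [p] at [(0, 0)] is the largest of its column,
so that the multipliers of the elimination have modulus at most [1] and the
Schur complement [M'] of [p] has entries at most [2 K]. The tail of [z] then
satisfies the hypothesis for [M'] with radius [2 r], and, the tail being fixed,
the first coordinate of [z] ranges over at most [(2 r + |p|) / |p|] integers.
Finally [det M = p det M']. *)
Lemma lattice_points_le n (K r : R) : 0 <= K -> 0 <= r ->
  exists2 C, 0 <= C & forall (M : 'M[R]_n) (s : seq 'cV[int]_n),
    `|M| <= K -> uniq s -> {in s, forall z, `|M *m map_mx intr z| <= r} ->
    (size s)%:R * `|\det M| <= C.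
Proof.
elim: n K r => [|n IH] K r K0 r0.
  exists 1 => // M s _ su _; rewrite det_mx00 normr1 mulr1 lern1.
  rewrite (@uniq_leq_size _ s [:: 0])// => z _.
  by rewrite inE; apply/eqP/matrixP => -[].
have [C' C'0 HC'] := IH (2 * K) (2 * r) ltac:(lra) ltac:(lra).
exists (C' * (2 * r + K)); first by rewrite mulr_ge0//; lra.
suff main (M : 'M[R]_(1 + n)) (s : seq 'cV[int]_(1 + n)) : M 0 0 != 0 ->
    (forall i, `|M i 0| <= `|M 0 0|) -> `|M| <= K -> uniq s ->
    {in s, forall z, `|M *m map_mx intr z| <= r} ->
    (size s)%:R * `|\det M| <= C' * (2 * r + K).
  move=> M s MK su sr.
  have [i0 _ i0max] :=
    @arg_maxP _ _ 'I_n.+1 ord0 xpredT (fun i => `|M i 0|) isT.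
  (* If even the largest entry of the column is 0, the determinant vanishes. *)
  have [Mi0|Mi0] := eqVneq (M i0 0) 0.
    suff -> : \det M = 0 by rewrite normr0 mulr0 mulr_ge0//; lra.
    rewrite (expand_det_col _ 0) big1// => i _.
    have := i0max i isT; rewrite /= Mi0 normr0 normr_le0 => /eqP ->.
    by rewrite mul0r.
  have <- : `|\det (xrow i0 0 M)| = `|\det M|.
    by rewrite xrowE det_mulmx det_perm normrM normrX normrN1 expr1n mul1r.
  have xE i j : xrow i0 0 M i j = M (tperm i0 0 i) j by rewrite mxE.
  have ent_le (N : 'cV[R]_n.+1) b i j : `|N| <= b -> `|N (tperm i0 0 i) j| <= b.
    by apply: le_trans; exact: entry_le_norm.
  apply: main => //.
  - by rewrite xE tpermR.
  - by move=> i; rewrite !xE tpermR; exact: i0max.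
  - apply: norm_le_entries => // i j; rewrite xE.
    by rewrite (le_trans (entry_le_norm _ _ _)).
  - move=> z /sr zr; apply: norm_le_entries => // i j.
    by rewrite xrowE -mulmxA -xrowE [_ i j]mxE; exact: ent_le.
move=> p0 pmax MK su sr.
set p := M 0 0 in p0 pmax.
set M' := drsubmx M - p^-1 *: (dlsubmx M *m ursubmx M).
have detM : \det M = p * \det M'.
  rewrite {1}(schur_factor p0) det_mulmx det_lblock det_ublock.
  by rewrite !det1 det_scalar1 !mul1r.
have MiK i j : `|M i j| <= K by rewrite (le_trans (entry_le_norm _ _ _)).
have mul_le i : `|p^-1 * M i 0| <= 1.
  by rewrite normrM normfV ler_pdivrMl ?normr_gt0// mulr1.
have M'K : `|M'| <= 2 * K.
  apply: norm_le_entries => [|i j]; first lra.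
  rewrite !mxE big_ord1 !mxE mulrA lshift0.
  have := MiK (rshift 1 i) (rshift 1 j); have := MiK 0 (rshift 1 j).
  move=> h1 h2; have h3 := mul_le (rshift 1 i).
  rewrite (le_trans (ler_normB _ _))// normrM.
  have := ler_pM (normr_ge0 _) (normr_ge0 _) h3 h1; lra.
pose f := fun z : 'cV[int]_(1 + n) => dsubmx z.
have row0 (z : 'cV[int]_(1 + n)) : (M *m map_mx intr z) 0 0 =
    p * (z 0 0)%:~R + (ursubmx M *m map_mx intr (f z)) 0 0.
  rewrite mxE big_ord_recl !mxE; congr (_ + _); apply: eq_bigr => i _.
  by rewrite !mxE lshift0 rshift1.
have rowd (z : 'cV[int]_(1 + n)) i : (M' *m map_mx intr (f z)) i 0 =
    (M *m map_mx intr z) (rshift 1 i) 0 -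
    p^-1 * M (rshift 1 i) 0 * (M *m map_mx intr z) 0 0.
  have rowi : (M *m map_mx intr z) (rshift 1 i) 0 =
      M (rshift 1 i) 0 * (z 0 0)%:~R + (drsubmx M *m map_mx intr (f z)) i 0.
    rewrite mxE big_ord_recl !mxE; congr (_ + _); apply: eq_bigr => j _.
    by rewrite !mxE !rshift1.
  rewrite row0 rowi mulmxBl -scalemxAl -mulmxA.
  move: (ursubmx M *m _) (drsubmx M *m _) => U D.
  by rewrite !mxE big_ord1 !mxE lshift0; field.
have fiber : forall x, x \in s ->
    (count (fun y => f y == f x) s)%:R <= (2 * r + `|p|) / `|p|.
  move=> x xs; rewrite ler_pdivlMr ?normr_gt0// -size_filter.
  set l := [seq y <- s | f y == f x].
  rewrite -(size_map (fun z : 'cV[int]_(1 + n) => z 0 0)).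
  apply: (@size_int_interval_le p ((ursubmx M *m map_mx intr (f x)) 0 0) r)
    => //.
    rewrite map_inj_in_uniq ?filter_uniq// => y z.
    rewrite !mem_filter => /andP[/eqP yx _] /andP[/eqP zx _] yz.
    rewrite -[y]vsubmxK -[z]vsubmxK -!/(f _) yx zx; congr col_mx.
    by apply/matrixP => i j; rewrite !ord1 !mxE lshift0.
  move=> _ /mapP[z + ->]; rewrite mem_filter => /andP[/eqP zx zs].
  by rewrite -zx -row0 (le_trans (entry_le_norm _ _ _))// sr.
have img : (size (undup (map f s)))%:R * `|\det M'| <= C'.
  apply: HC' => //; first exact: undup_uniq.
  move=> y; rewrite mem_undup => /mapP[z zs ->].
  apply: norm_le_entries => [|i j]; first lra.
  have vr k l : `|(M *m map_mx intr z) k l| <= r.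
    by rewrite (le_trans (entry_le_norm _ _ _))// sr.
  rewrite ord1 rowd (le_trans (ler_normB _ _))// normrM.
  have := ler_pM (normr_ge0 _) (normr_ge0 _) (mul_le (rshift 1 i)) (vr 0 0).
  have := vr (rshift 1 i) 0; lra.
have := size_le_fibers fiber; rewrite mulrA ler_pdivlMr ?normr_gt0//.
rewrite detM normrM mulrA => h.
have := ler_wpM2r (normr_ge0 (\det M')) h => /le_trans; apply.
rewrite mulrAC ler_pM ?mulr_ge0//; first by have := normr_ge0 p; lra.
by have := MiK 0 0; rewrite -/p; lra.
Qed.
End Counting.

(** * Bounded negative powers imply the counting estimate *)

Lemma det_expr (R : comNzRingType) n (A : 'M[R]_n.+1) k :
  \det (A ^+ k) = \det A ^+ k.
Proof. by elim: k => [|k IH]; rewrite ?expr0 ?det1// !exprS -IH -det_mulmx. Qed.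

Section CountingMeasure.
Variables (R : realType) (T : choiceType).

Lemma counting_le (X : set T) (C : R) :
  (forall s : seq T, uniq s -> (forall x, x \in s -> X x) ->
    (size s)%:R <= C) ->
  (counting X <= C%:E)%E.
Proof.
move=> sC; rewrite /counting; case: asboolP => [finX|/infinite_set_fset infX].
  rewrite lee_fin; apply: sC; first exact: fset_uniq.
  by move=> x; rewrite in_fset_set// inE.
have [B BX] := infX (Num.truncn C).+1.
have /sC BC : uniq (enum_fset B) by exact: fset_uniq.
have := BC (fun x xB => BX x xB) => {}BC.
rewrite -(ler_nat R) => /le_trans /(_ BC); rewrite leNgt => /negP[].
exact: truncnS_gt.
Qed.

Lemma counting_ge (X : set T) (s : seq T) :
  uniq s -> (forall x, x \in s -> X x) ->
  ((size s)%:R%:E <= counting X :> \bar R)%E.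
Proof.
move=> us sX; rewrite /counting; case: asboolP => finX; last by rewrite leey.
rewrite lee_fin ler_nat; apply: uniq_leq_size => // x /sX Xx.
by rewrite in_fset_set// inE.
Qed.
End CountingMeasure.

(** Stated through [A ^ j] rather than through its inverse, this says that the
matrices [A ^ -j], [j >= 0], are uniformly bounded. *)
Definition backward_bounded (R : realType) n (A : 'M[R]_n.+1) : Prop :=
  exists2 K : R, 0 < K &
    forall (j : nat) (x : 'cV[R]_n.+1), `|x| <= K * `|A ^+ j *m x|.

Section SufficientCondition.
Variables (R : realType) (n : nat) (A : 'M[R]_n.+1).

(** The norm is a maximum over the entries, so that lower bounds for [Y] pass
from vectors to matrices column by column. *)
Lemma norm_le_mulmx_columns (Y : 'M[R]_n.+1) (K : R) p (X : 'M[R]_(n.+1, p)) :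
  0 <= K -> (forall x : 'cV[R]_n.+1, `|x| <= K * `|Y *m x|) ->
  `|X| <= K * `|Y *m X|.
Proof.
move=> K0 HY; apply: norm_le_entries => [|i j]; first by rewrite mulr_ge0.
have -> : X i j = col j X i 0 by rewrite mxE.
rewrite (le_trans (entry_le_norm _ _ _))// (le_trans (HY _))// ler_wpM2l//.
apply: norm_le_entries => // k l.
have -> : (Y *m col j X) k l = (Y *m X) k j.
  by rewrite !mxE; apply: eq_bigr => a _; rewrite mxE.
exact: entry_le_norm.
Qed.

(** For [j >= 0], [P z] is in [A ^ j B(0, r)] only if [|A ^ -j P z| < r], where
[A ^ -j P] has norm at most [K |P|] and determinant [det P / det A ^ j]. For
[j < 0], [P z] has norm at most [K r]. *)
Lemma backward_bounded_counting (Gamma : set 'cV[R]_n.+1) : A \in unitmx ->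
  backward_bounded A -> full_rank_lattice Gamma ->
  lattice_counting_estimate A Gamma.
Proof.
move=> Au [K K0 HK] [P Pu ->] r r0.
have P0 : 0 < `|\det P| by rewrite normr_gt0 -unitfE -unitmxE.
have [C1 C10 H1] := @lattice_points_le R n.+1 (K * `|P|) r
  ltac:(by rewrite mulr_ge0 // ltW) (ltW r0).
have [C2 C20 H2] := @lattice_points_le R n.+1 `|P| (K * r)
  ltac:(by []) ltac:(by rewrite mulr_ge0 // ltW).
exists ((C1 + C2) / `|\det P|) => j; apply: counting_le => s us sX.
have sg y : exists z : 'cV[int]_n.+1, y \in s -> P *m map_mx intr z = y.
  have [ys|ys] := boolP (y \in s); last by exists 0.
  by have [[z _ zy] _] := sX y ys; exists z.
pose g y := projT1 (cid (sg y)).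
have gE y : y \in s -> P *m map_mx intr (g y) = y by rewrite /g; case: cid.
have ug : uniq (map g s).
  rewrite map_inj_in_uniq// => y1 y2 /gE {2}<- /gE {2}<- -> //.
case: j sX => m sX.
- have Yu : A ^+ m \in unitmx by rewrite -[_ \in _]/(_ \is a GRing.unit) unitrX.
  have := H1 (invmx (A ^+ m) *m P) (map g s) _ ug; rewrite size_map => /(_ _ _)/wrap[].
  + rewrite (le_trans (norm_le_mulmx_columns _ (ltW K0) (HK m)))//.
    by rewrite mulKVmx.
  + move=> _ /mapP[y ys ->]; rewrite -mulmxA gE//.
    have [_ [x xr <-]] := sX y ys.
    rewrite mulKmx// ltW// (le_lt_trans (norm_le_enorm _))//.
  rewrite det_mulmx normrM det_inv normfV det_expr normrX mulrCA mulrC.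
  have A0 : 0 < `|\det A| ^+ m.
    by rewrite exprn_gt0// normr_gt0 -unitfE -unitmxE.
  rewrite -ler_pdivlMr ?invr_gt0// invrK -ler_pdivlMr// => /le_trans; apply.
  rewrite mulrAC ler_pM//.
  + by rewrite divr_ge0// ltW.
  + by rewrite ler_pM2r ?invr_gt0// lerDl.
  + by rewrite -exprnP le_max lexx orbT.
- have Yu : A ^+ m.+1 \in unitmx by rewrite -[_ \in _]/(_ \is a GRing.unit) unitrX.
  have := H2 P (map g s) (lexx _) ug; rewrite size_map => /(_ _)/wrap[].
    move=> _ /mapP[y ys ->]; rewrite gE//.
    have [_ [x xr <-]] := sX y ys.
    rewrite (le_trans (HK m.+1 _))// mulKVmx// ler_wpM2l ?(ltW K0)//.
    by rewrite ltW// (le_lt_trans (norm_le_enorm _)).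
  rewrite -ler_pdivlMr// => /le_trans; apply.
  rewrite -[leLHS]mulr1 ler_pM//.
  + by rewrite divr_ge0// ltW.
  + by rewrite ler_pM2r ?invr_gt0// lerDr.
  + by rewrite le_max lexx.
Qed.
End SufficientCondition.

(** * The counting estimate for all lattices implies bounded negative powers *)

Section Necessity.
Variable R : realType.

(** Baire's theorem for the complete normed module structure that matrices get
from their entrywise completeness and the maximum norm. *)
Lemma matrix_Baire m p (F : (set 'M[R]_(m, p))^nat) :
  (forall i, open (F i) /\ dense (F i)) -> dense (\bigcap_i F i).
Proof.
exact: (@Baire R (HB.pack_for (completeNormedModType R) 'M[R]_(m, p))).
Qed.

(** The row kernel of [P] is fixed by [1 - P], which is contracting. *)
Lemma unitmx_near_one n (P : 'M[R]_n) : n%:R * `|1%:M - P| < 1 -> P \in unitmx.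
Proof.
move=> P1; rewrite -row_free_unit -kermx_eq0 -normr_eq0.
have kE : kermx P = kermx P *m (1%:M - P).
  by rewrite mulmxBr mulmx1 mulmx_ker subr0.
have := norm_mulmx_le (kermx P) (1%:M - P); rewrite -kE mulrAC => kle.
apply/eqP/le_anti; rewrite normr_ge0 andbT leNgt; apply/negP => k0.
by move: kle; rewrite leNgt gtr_pMl ?P1.
Qed.

(** [P - a] is invertible unless [a] is one of the finitely many eigenvalues. *)
Lemma unitmx_dense n (P : 'M[R]_n) (e : R) : 0 < e ->
  exists2 P', `|P' - P| < e & P' \in unitmx.
Proof.
move=> e0; pose q := char_poly P.
pose s := [seq e / k.+2%:R | k <- iota 0 (size q)].
have /allPn[a /mapP[k _ ak] qa] : ~~ all (root q) s.
  apply/negP => /max_poly_roots; rewrite -size_poly_eq0 size_char_poly => /(_ isT).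
  rewrite map_inj_uniq ?iota_uniq => [|i j /(mulfI (lt0r_neq0 e0))/invr_inj/eqP].
    by move=> /(_ isT); rewrite size_map size_iota size_char_poly ltnn.
  by rewrite eqr_nat => /eqP [].
exists (P - a%:M).
  rewrite addrAC subrr add0r normrN; apply: le_lt_trans (_ : a < e).
    apply: norm_le_entries => [|i j]; first by rewrite ak divr_ge0// ltW.
    have a0 : 0 <= a by rewrite ak divr_ge0// ltW.
    by rewrite mxE; case: eqP => _; rewrite ?mulr1n ?mulr0n ?normr0// ger0_norm.
  by rewrite ak ltr_pdivrMr// ltr_pMr// ltr1n.
by rewrite -row_free_unit -kermx_eq0; move: qa; rewrite -eigenvalue_root_char negbK.
Qed.

(** Rounding the coordinates of [t v] in the basis [P] gives a lattice point
[P z] at distance at most [kappa] from [t v], so [|z|] grows with [t]. The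
correction of [P] by a rank one matrix supported on the column [i0], where
[|z|] is attained, carries [P z] to [t v] and has size at most [kappa / |z|].
The threshold [t] does not depend on the direction [v]. *)
Lemma lattice_point_on_ray n (P : 'M[R]_n.+1) (e : R) : P \in unitmx -> 0 < e ->
  exists2 t : R, 0 < t & forall v : 'cV[R]_n.+1, `|v| = 1 ->
    exists P' (z : 'cV[int]_n.+1),
      [/\ `|P' - P| < e, z != 0 & P' *m map_mx intr z = t *: v].
Proof.
move=> Pu e0; pose kappa := n.+1%:R * `|P| + 1.
have kappa0 : 0 < kappa by rewrite ltr_wpDl// mulr_ge0.
exists (kappa + kappa * (kappa / e + 1)).
  by rewrite addr_gt0// mulr_gt0// addr_gt0// divr_gt0.
set t := kappa + _; move=> v v1.
have t0 : 0 < t by rewrite addr_gt0// mulr_gt0// addr_gt0// divr_gt0.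
have [y yE] : exists y, P *m y = t *: v.
  by exists (invmx P *m (t *: v)); rewrite mulKVmx.
pose z := \col_i Num.floor (y i 0); pose zr := map_mx intr z : 'cV[R]_n.+1.
pose d := P *m zr - t *: v.
have dE : d = P *m (zr - y) by rewrite mulmxBr yE.
have d_le : `|d| <= kappa.
  rewrite dE (le_trans (norm_mulmx_le _ _))//.
  rewrite (@le_trans _ _ (n.+1%:R * `|P|))//; last by rewrite lerDl.
  rewrite ler_piMr ?mulr_ge0//; apply: norm_le_entries => // i j.
  rewrite ord1 !mxE ler_norml; have := Num.Theory.floor_itv (y i 0).
  by rewrite intrD => /andP[y1 y2]; apply/andP; split; lra.
have [i0 _ i0max] :=
  @arg_maxP _ _ 'I_n.+1 ord0 xpredT (fun i => `|zr i 0|) isT.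
have zi0 : kappa / e + 1 <= `|zr i0 0|.
  have zr_le : `|zr| <= `|zr i0 0|.
    by apply: norm_le_entries => // i j; rewrite ord1; exact: i0max.
  rewrite -(ler_pM2l kappa0) -(lerD2l kappa) -/t.
  have -> : t = `|t *: v| by rewrite normrZ v1 mulr1 gtr0_norm.
  have -> : t *: v = P *m zr - d by rewrite /d opprB addrC subrK.
  rewrite (le_trans (ler_normB _ _))// addrC lerD//.
  rewrite (le_trans (norm_mulmx_le _ _))//.
  by rewrite ler_pM ?mulr_ge0// lerDl.
have zi0_gt0 : 0 < `|zr i0 0|.
  by apply: lt_le_trans zi0; rewrite addr_gt0// divr_gt0.
exists (P - (zr i0 0)^-1 *: (d *m delta_mx 0 i0)), z; split.
- rewrite addrAC subrr add0r normrN normrZ normfV mulrC ltr_pdivrMr//.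
  have : `|d *m delta_mx 0 i0| <= kappa.
    apply: norm_le_entries => [|i j]; first exact: ltW.
    rewrite mxE big_ord1 [delta_mx _ _ _ _]mxE eqxx; case: (j == i0).
      by rewrite mulr1 (le_trans (entry_le_norm _ _ _)).
    by rewrite mulr0 normr0 ltW.
  move/le_lt_trans; apply; rewrite -ltr_pdivrMl// mulrC.
  by apply: lt_le_trans zi0; rewrite ltrDl.
- by apply: contraTneq zi0_gt0 => z0; rewrite /zr z0 map_mx0 mxE normr0 ltxx.
- rewrite -/zr mulmxBl -scalemxAl -mulmxA.
  have -> : delta_mx 0 i0 *m zr = (zr i0 0)%:M.
    by rewrite -rowE; apply/matrixP => i j; rewrite !ord1 !mxE eqxx.
  rewrite mul_mx_scalar scalerA mulVf -?normr_gt0// scale1r /d opprB addrC subrK //.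
Qed.

Variables (n : nat) (A : 'M[R]_n.+1).

(** A condition on the single point [k P z] suffices: balls around the origin
are star-shaped, so [A ^ -j B(0, 1)] contains the [k] points [i P z], [i < k],
which are distinct when [P] is invertible because [z] is non-zero. Being one
strict inequality, the condition is open in [P]. *)
Definition many_points (k : nat) : set 'M[R]_n.+1 :=
  [set P | exists j (z : 'cV[int]_n.+1),
     z != 0 /\ `|k%:R *: (A ^+ j *m (P *m map_mx intr z))| < 1].

Lemma open_many_points k : open (many_points k).
Proof.
rewrite openE => P [j [z [z0 Pz]]].
set zr := map_mx intr z in Pz *; set a := `|_| in Pz.
pose c := k%:R * (n.+1%:R * `|A ^+ j| * (n.+1%:R * `|zr|)) + 1.
have c0 : 0 < c by rewrite ltr_wpDl// !mulr_ge0.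
apply/nbhs_ballP; exists ((1 - a) / c) => [|Q].
  by rewrite /= divr_gt0 ?subr_gt0.
rewrite -ball_normE /= ltr_pdivlMr// => PQ; exists j, z; split=> //; rewrite -/zr.
have -> : Q = P - (P - Q) by rewrite opprB addrC subrK.
rewrite mulmxBl mulmxBr scalerBr (le_lt_trans (ler_normB _ _))// -/a -ltrBrDl.
apply: le_lt_trans PQ; rewrite normrZ ger0_norm//.
rewrite (@le_trans _ _ (k%:R * (n.+1%:R * `|A ^+ j| *
  (n.+1%:R * `|P - Q| * `|zr|))))//.
  rewrite ler_wpM2l// (le_trans (norm_mulmx_le _ _))// ler_wpM2l ?mulr_ge0//.
  exact: norm_mulmx_le.
rewrite [leLHS](_ : _ = `|P - Q| * (c - 1)); last by rewrite /c; ring.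
by rewrite ler_wpM2l// gerBl.
Qed.

(** As the negative powers of [A] are unbounded, some [w] satisfies
[|A ^ j w| < |w| / ((k + 1) t)], where [t] is the threshold of
[lattice_point_on_ray]; the direction to hit is that of [w]. *)
Lemma dense_many_points k : ~ backward_bounded A -> dense (many_points k).
Proof.
move=> nbA O [P0 OP0]; rewrite openE => /(_ _ OP0)/nbhs_ballP[e /= e0 eO].
have [P1 P01 P1u] := unitmx_dense P0 (divr_gt0 e0 (ltr0n R 2)).
have [t t0 ray] := lattice_point_on_ray P1u (divr_gt0 e0 (ltr0n R 2)).
have kt0 : 0 < k.+1%:R * t by rewrite mulr_gt0.
have [j [w jw]] : exists j (w : 'cV[R]_n.+1),
    k.+1%:R * t * `|A ^+ j *m w| < `|w|.
  apply: contrapT => nw; apply: nbA; exists (k.+1%:R * t) => // j w.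
  by rewrite leNgt; apply/negP => ?; apply: nw; exists j, w.
have w0 : 0 < `|w| by apply: le_lt_trans jw; rewrite mulr_ge0// ltW.
have [|P [z [P1P z0 Pz]]] := ray (`|w|^-1 *: w).
  by rewrite normrZ gtr0_norm ?invr_gt0// mulVf ?gt_eqF.
exists P; split.
  apply: eO; rewrite -ball_normE /=.
  rewrite (_ : P0 - P = - (P1 - P0) - (P - P1)); last first.
    by rewrite !opprB addrA subrK.
  by rewrite (le_lt_trans (ler_normB _ _))// normrN; lra.
exists j, z; split=> //.
have -> : `|k%:R *: (A ^+ j *m (P *m map_mx intr z))| =
    `|w|^-1 * (k%:R * t * `|A ^+ j *m w|).
  rewrite Pz -!scalemxAr !normrZ normrV ?unitfE ?gt_eqF// normr_id.
  by rewrite (gtr0_norm t0) ger0_norm//; ring.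
rewrite ltr_pdivrMl// mulr1; apply: le_lt_trans jw.
by rewrite ler_wpM2r// ler_wpM2r ?(ltW t0)// ler_nat.
Qed.

(** The exponents [-j] are non-positive, so the estimate would bound the number
of points by one constant [C], and [many_points] contradicts it as soon as
[k > C]. A ball around the identity ensures that the matrix found by the Baire
property is invertible. *)
Lemma counting_backward_bounded : A \in unitmx -> 1 < `|\det A| ->
  (forall Gamma, full_rank_lattice Gamma -> lattice_counting_estimate A Gamma) ->
  backward_bounded A.
Proof.
move=> Au detA LCE; apply: contrapT => nbA.
have c0 : 0 < n.+1%:R^-1 :> R by rewrite invr_gt0.
have [P [P1 PU]] : ball (1%:M : 'M[R]_n.+1) n.+1%:R^-1 `&`
    \bigcap_k many_points k !=set0.
  apply: matrix_Baire => [k||].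
  - by split; [exact: open_many_points | exact: dense_many_points].
  - by exists 1%:M; exact: ballxx.
  - exact: ball_open.
have Pu : P \in unitmx.
  apply: unitmx_near_one; move: P1.
  by rewrite -ball_normE /= mulrC -ltr_pdivlMr// div1r.
(* The radius n + 1 absorbs the comparison of the two norms. *)
have [C HC] := LCE _ (ex_intro2 _ _ P Pu erefl) n.+1%:R (ltr0n _ _).
have [j [z [z0 Pz]]] := PU (Num.truncn C).+1 I.
set k := (Num.truncn C).+1 in Pz; set zr := map_mx intr z in Pz.
have [i zi] : exists i, z i 0 != 0.
  apply: contrapT => nz; case/eqP: z0; apply/matrixP => i l; rewrite ord1 mxE.
  by apply/eqP/negPn/negP => zi; apply: nz; exists i.
pose s := [seq l%:R *: (P *m zr) | l <- iota 0 k].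
have us : uniq s.
  rewrite map_inj_uniq ?iota_uniq// => l m lm.
  have : l%:R *: zr = m%:R *: zr.
    by apply: (can_inj (mulKmx Pu)); rewrite -!scalemxAr.
  move/matrixP/(_ i 0); rewrite !mxE => /mulIf.
  by rewrite intr_eq0 => /(_ zi)/eqP; rewrite eqr_nat => /eqP.
have := HC (- j%:Z); set X := (X in counting X) => HX.
have sX x : x \in s -> X x.
  move=> /mapP[l]; rewrite mem_iota add0n /= => lk ->; split.
    exists (z *+ l) => //; rewrite scalemxAr; congr mulmx.
    by apply/matrixP => a b; rewrite !mxE mulmxnE rmorphMn mulr_natl.
  exists (A ^+ j *m (l%:R *: (P *m zr))).
    apply: le_lt_trans (enorm_le_norm _) _; rewrite gtr_pMr//.
    apply: le_lt_trans Pz; rewrite -scalemxAr !normrZ ler_wpM2r//.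
    by rewrite !ger0_norm// ler_nat ltnW.
  rewrite -exprnN mulKmx//.
  by rewrite -[_ \in _]/(_ \is a GRing.unit) unitrX.
have := le_trans (counting_ge R us sX) HX.
rewrite lee_fin size_map size_iota => kC.
have := truncnS_gt C; rewrite -/k ltNge => /negP; apply.
rewrite (le_trans kC)// (elimT max_idPl) ?mulr1//.
by rewrite -exprnN invf_le1 ?exprn_gt0 ?exprn_ege1 ?(lt_trans ltr01)// ltW.
Qed.
End Necessity.

(** * Cluster points of the powers of a matrix *)

Section Expansion.
Variable R : realType.

(** Bolzano-Weierstrass, through the identification of matrices with row
vectors, for which boxes are compact. *)
Lemma bounded_seq_cluster m n (u : nat -> 'M[R]_(m, n)) (K : R) :
  (forall j, `|u j| <= K) ->
  exists L, forall e N, 0 < e -> exists2 j, (N <= j)%N & `|u j - L| < e.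
Proof.
move=> uK.
have := @rV_compact R (m * n) (fun=> `[- K, K]%classic)
  (fun=> @segment_compact R _ _).
move=> /(_ ((fun j => mxvec (u j)) @ \oo)) [].
  exists 0%N => // j _ i /=; rewrite in_itv /= -ler_norml.
  rewrite -[_ ord0 i]/(mxvec _ 0 i); case/mxvec_indexP: i => a b.
  by rewrite mxvecE (le_trans (entry_le_norm _ _ _)).
move=> v [_ vcl]; exists (vec_mx v) => e N e0.
have FN : ((fun j => mxvec (u j)) @ \oo)
    [set mxvec (u j) | j in [set j | (N <= j)%N]].
  by exists N => // j /= Nj; exists j.
have [w [[j Nj <-]]] := vcl _ _ FN (nbhsx_ballx v e e0).
rewrite -ball_normE /= => vuj; exists j => //.
apply: le_lt_trans vuj; apply: norm_le_entries => // a b.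
rewrite distrC; apply: le_trans (entry_le_norm _ 0 (mxvec_index a b)).
by rewrite !mxE mxvecE.
Qed.

(** The instance of the count of integer points where only [0] is counted. *)
Lemma det_bounded n (K : R) : 0 <= K ->
  exists C, forall M : 'M[R]_n, `|M| <= K -> `|\det M| <= C.
Proof.
move=> K0; have [C _ HC] := @lattice_points_le R n K 0 K0 (lexx 0); exists C => M MK.
rewrite -[leLHS]mul1r; apply: (HC M [:: 0]) => // z; rewrite inE => /eqP ->.
by rewrite map_mx0 mulmx0 normr0.
Qed.

Definition power_cluster n (B L : 'M[R]_n.+1) : Prop :=
  forall e N, 0 < e -> exists2 j, (N <= j)%N & `|B ^+ j - L| < e.

Section PowerCluster.
Variables (n : nat) (B : 'M[R]_n.+1).

Lemma norm_mulr_le (M N : 'M[R]_n.+1) : `|M * N| <= n.+1%:R * `|M| * `|N|.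
Proof. exact: norm_mulmx_le. Qed.

Lemma power_cluster_mul (K : R) (L M : 'M[R]_n.+1) :
  (forall j, `|B ^+ j| <= K) ->
  power_cluster B L -> power_cluster B M -> power_cluster B (L * M).
Proof.
move=> BK BL BM e N e0; have K0 : 0 <= K := le_trans (normr_ge0 _) (BK 0%N).
pose s := n.+1%:R * (K + `|L| + 1).
have s0 : 0 < s by rewrite mulr_gt0// ltr_wpDl// addr_ge0.
have [i Ni Li] := BL _ N (divr_gt0 e0 s0).
have [j Nj Mj] := BM _ 0%N (divr_gt0 e0 s0).
exists (i + j)%N; first exact: (leq_trans Ni (leq_addr _ _)).
have -> : B ^+ (i + j) - L * M = (B ^+ i - L) * B ^+ j + L * (B ^+ j - M).
  by rewrite exprD mulrBl mulrBr addrA subrK.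
rewrite (le_lt_trans (ler_normD _ _))//.
apply: (@le_lt_trans _ _
  (n.+1%:R * (e / s) * K + n.+1%:R * `|L| * (e / s))).
  apply: lerD; apply: le_trans (norm_mulr_le _ _) _.
    by rewrite ler_pM ?mulr_ge0// ler_wpM2l// ltW.
  by rewrite ler_wpM2l ?mulr_ge0// ltW.
have -> : n.+1%:R * (e / s) * K + n.+1%:R * `|L| * (e / s) =
    e - n.+1%:R * (e / s).
  have -> : e = (e / s) * s by rewrite divfK ?gt_eqF.
  by rewrite mulfK ?gt_eqF// /s; ring.
by rewrite ltrBlDr ltrDl mulr_gt0// divr_gt0.
Qed.

Lemma power_cluster_comm (L : 'M[R]_n.+1) : power_cluster B L -> B * L = L * B.
Proof.
move=> BL; apply/eqP; rewrite -subr_eq0 -normr_eq0; set a := `|_|.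
apply/eqP/le_anti; rewrite normr_ge0 andbT leNgt; apply/negP => a0.
pose s := n.+1%:R * `|B| * 2 + 1.
have s0 : 0 < s by rewrite ltr_wpDl// !mulr_ge0.
have [j _ Bj] := BL _ 0%N (divr_gt0 a0 s0).
suff : a <= n.+1%:R * `|B| * 2 * (a / s).
  have {1}-> : a = (a / s) * s by rewrite divfK ?gt_eqF.
  rewrite mulrC ler_pM2r ?divr_gt0// /s; lra.
have {1}-> : a = `|B * (L - B ^+ j) + (B ^+ j - L) * B|.
  by rewrite mulrBl mulrBr addrA -exprS -exprSr subrK.
rewrite (le_trans (ler_normD _ _))// [leRHS](_ : _ =
  n.+1%:R * `|B| * (a / s) + n.+1%:R * `|B| * (a / s)); last by ring.
apply: lerD.
  by rewrite (le_trans (norm_mulr_le _ _))// distrC ler_wpM2l ?mulr_ge0// ltW.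
by rewrite (le_trans (norm_mulr_le _ _))// mulrAC ler_wpM2l ?mulr_ge0// ltW.
Qed.

(** If [L] were invertible, the powers [B ^ j] close to [L] would have uniformly
bounded inverses, hence inverses of bounded determinant, whereas
[|det B| ^ -j] tends to infinity. *)
Lemma power_cluster_singular (L : 'M[R]_n.+1) : B \is a GRing.unit ->
  `|\det B| < 1 -> power_cluster B L -> L \notin unitmx.
Proof.
move=> Bu detB BL; apply/negP => Lu.
pose kappa := n.+1%:R * `|invmx L| + 1.
have kappa0 : 0 < kappa by rewrite ltr_wpDl// mulr_ge0.
have LK (x : 'cV[R]_n.+1) : `|x| <= kappa * `|L *m x|.
  rewrite -{1}[x](mulKmx Lu) (le_trans (norm_mulmx_le _ _))//.
  by rewrite ler_wpM2r// lerDl.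
have [C HC] := @det_bounded n.+1 (2 * kappa * `|1 : 'M[R]_n.+1|)
  ltac:(by rewrite !mulr_ge0 // ltW).
have dB0 : 0 < `|\det B| by rewrite normr_gt0 -unitfE -unitmxE.
have [N HN] := @expr_unbounded R `|\det B|^-1 C ltac:(by rewrite invf_gt1).
pose d := kappa * n.+1%:R * 2.
have d0 : 0 < d by rewrite !mulr_gt0.
have [j Nj BLj] := BL d^-1 N ltac:(by rewrite invr_gt0).
have Bju : B ^+ j \is a GRing.unit by rewrite unitrX.
have := HN j Nj; rewrite ltNge => /negP; apply.
have -> : `|\det B|^-1 ^+ j = `|\det (B ^+ j)^-1|.
  by rewrite det_inv det_expr normfV normrX exprVn.
apply: HC.
(* The choice of d makes |L x - B ^ j x| at most |x| / (2 kappa). *)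
have BjK (x : 'cV[R]_n.+1) : `|x| <= 2 * kappa * `|B ^+ j *m x|.
  have h1 : `|L *m x| <= `|B ^+ j *m x| + n.+1%:R * d^-1 * `|x|.
    have -> : L = B ^+ j - (B ^+ j - L) by rewrite opprB addrC subrK.
    rewrite mulmxBl (le_trans (ler_normB _ _))// lerD2l.
    rewrite (le_trans (norm_mulmx_le _ _))//.
    by rewrite ler_wpM2r// ler_wpM2l// ltW.
  have := le_trans (LK x) (ler_wpM2l (ltW kappa0) h1); rewrite mulrDr.
  have -> : kappa * (n.+1%:R * d^-1 * `|x|) = 2^-1 * `|x|.
    by rewrite /d; field; rewrite nat1r pnatr_eq0 (gt_eqF kappa0).
  lra.
have kappa2 : 0 <= 2 * kappa by rewrite mulr_ge0// ltW.
have := norm_le_mulmx_columns (B ^+ j)^-1 kappa2 BjK.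
by rewrite -[_ *m _]/(_ * _) divrr.
Qed.
End PowerCluster.
End Expansion.

(** * Expanding splittings and bounded negative powers *)

Section Splitting.
Variables (R : realType) (n : nat).
Local Notation V := 'cV[R]_n.+1.

Lemma endomorphism_bounded (f : 'End(V)) :
  exists2 K, 0 <= K & forall x : V, `|f x| <= K * `|x|.
Proof.
exists (\sum_(i < n.+1) `|f (delta_mx i 0)|) => [|x]; first exact: sumr_ge0.
rewrite {1}[x]matrix_sum_delta linear_sum (le_trans (ler_norm_sum _ _ _))//.
rewrite mulr_suml.
apply: ler_sum => i _; rewrite big_ord1 linearZ normrZ mulrC ler_wpM2l//.
exact: entry_le_norm.
Qed.

Lemma mulmx_linfunE (M : 'M[R]_n.+1) (x : V) : linfun (mulmx M) x = M *m x.
Proof. by rewrite lfunE. Qed.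

Lemma mem_pow_invariant (A : 'M[R]_n.+1) (F : {vspace V}) :
  (linfun (mulmx A) @: F = F)%VS ->
  forall j x, x \in F -> A ^+ j *m x \in F.
Proof.
move=> AF j x xF; elim: j => [|j IH]; first by rewrite expr0 mul1mx.
by rewrite exprS -[_ * _]/(_ *m _) -mulmxA -mulmx_linfunE -AF memv_img.
Qed.

(** On [F] and on [E] the vector [A ^ j x] controls [x], and the components of
[A ^ j x] are those of [x] moved by [A ^ j], since [F] and [E] are invariant. *)
Lemma expanding_backward_bounded (A : 'M[R]_n.+1) :
  expanding_on_subspace A -> backward_bounded A.
Proof.
move=> [F _ [E [[FE FIE] [AF AE] [c [gamma [c1 gamma1 HF]]] [k k0 HE]]]].
have c0 : 0 < c := lt_le_trans ltr01 c1.
have EIF : (E :&: F = 0)%VS by rewrite capvC.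
have [KF KF0 piF] := endomorphism_bounded (daddv_pi F E).
have [KE KE0 piE] := endomorphism_bounded (daddv_pi E F).
have bF j y : y \in F -> `|y| <= c * n.+1%:R * `|A ^+ j *m y|.
  move=> yF; rewrite (le_trans (norm_le_enorm y))// -mulrA.
  rewrite (le_trans _ (ler_wpM2l (ltW c0) (enorm_le_norm _)))//.
  rewrite -ler_pdivrMl// (le_trans _ (HF j y yF))// ler_wpM2r ?enorm_ge0//.
  by rewrite ler_peMr ?invr_ge0 ?(ltW c0)// exprn_ege1// ltW.
have bE j y : y \in E -> `|y| <= k^-1 * n.+1%:R * `|A ^+ j *m y|.
  move=> yE; rewrite (le_trans (norm_le_enorm y))// -mulrA ler_pdivlMl//.
  by rewrite (le_trans (HE j y yE))// enorm_le_norm.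
exists (c * n.+1%:R * KF + k^-1 * n.+1%:R * KE + 1).
  by rewrite ltr_wpDl// addr_ge0// !mulr_ge0 ?invr_ge0 ?(ltW c0) ?(ltW k0).
move=> j x; set y := A ^+ j *m x.
pose xF := daddv_pi F E x; pose xE := daddv_pi E F x.
have xFF : xF \in F by exact: memv_pi.
have xEE : xE \in E by exact: memv_pi.
have xsum : xF + xE = x by apply: daddv_pi_add => //; rewrite FE memvf.
have ysum : y = A ^+ j *m xF + A ^+ j *m xE by rewrite -mulmxDr xsum.
have yFF := mem_pow_invariant AF j xFF.
have yEE := mem_pow_invariant AE j xEE.
have yF : daddv_pi F E y = A ^+ j *m xF.
  have yE0 : daddv_pi F E (A ^+ j *m xE) = 0.
    have := daddv_pi_add FIE (subvP (addvSr F E) _ yEE).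
    by rewrite (daddv_pi_id EIF yEE) => /(canRL (addrK _)); rewrite subrr.
  by rewrite ysum linearD /= yE0 addr0 daddv_pi_id.
have yE : daddv_pi E F y = A ^+ j *m xE.
  have yF0 : daddv_pi E F (A ^+ j *m xF) = 0.
    have := daddv_pi_add EIF (subvP (addvSr E F) _ yFF).
    by rewrite (daddv_pi_id FIE yFF) => /(canRL (addrK _)); rewrite subrr.
  by rewrite ysum linearD /= yF0 add0r daddv_pi_id.
rewrite -xsum (le_trans (ler_normD _ _))// !mulrDl mul1r -[leLHS]addr0 lerD//.
apply: lerD.
  rewrite (le_trans (bF j _ xFF))// -yF -[leRHS]mulrA.
  by rewrite ler_wpM2l ?mulr_ge0 ?(ltW c0).
rewrite (le_trans (bE j _ xEE))// -yE -[leRHS]mulrA.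
by rewrite ler_wpM2l ?mulr_ge0 ?invr_ge0 ?(ltW k0).
Qed.

(** Fitting's lemma at the first step: [f] maps [im f] onto [im (f ^ 2)], which
has the same dimension, so [f] is injective on [im f]. *)
Lemma stable_splitting (L : 'M[R]_n.+1) : let f : 'End(V) := linfun (mulmx L) in
  \dim (limg (linfun (mulmx (L * L)) : 'End(V))) = \dim (limg f) ->
  (lker f + limg f = fullv)%VS /\ (lker f :&: limg f = 0)%VS.
Proof.
move=> f rkL; have kI : (lker f :&: limg f = 0)%VS.
  apply/eqP; rewrite -dimv_eq0 -(eqn_add2r (\dim (f @: limg f))).
  rewrite capvC limg_ker_dim add0n -rkL eq_sym; apply/eqP; congr (\dim _).
  rewrite -limg_comp.
  congr (limg _); apply/lfunP => x.
  by rewrite comp_lfunE !mulmx_linfunE -[_ * _]/(_ *m _) mulmxA.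
split=> //; apply/eqP; rewrite eqEdim subvf /= dimv_disjoint_sum//.
by rewrite -(limg_ker_dim f fullv) capfv.
Qed.

(** Bernoulli's inequality bounds [(1 - 1 / (2 J)) ^ J] below by [1/2]. *)
Lemma exists_root_below_two (J : nat) : (0 < J)%N ->
  exists2 gamma : R, 1 < gamma & gamma ^+ J <= 2.
Proof.
move=> J0; pose h : R := (J%:R * 2)^-1.
have h0 : 0 < h by rewrite invr_gt0 mulr_gt0// ltr0n.
have hJ : J%:R * h = 2^-1.
  by rewrite /h invfM mulrA divff ?mul1r// pnatr_eq0 -lt0n.
have h2 : h <= 2^-1 by rewrite -hJ ler_peMl ?(ltW h0)// ler1n.
have h1 : 0 < 1 - h by lra.
exists (1 - h)^-1; first by rewrite invf_gt1//; lra.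
have := @bernoulli_le R (- h) J ltac:(lra).
rewrite mulrN hJ exprVn => hb.
rewrite -[leRHS]invrK lef_pV2 ?posrE ?exprn_gt0//; lra.
Qed.

(** The splitting is the one of a cluster point [L] of minimal rank. The bound
below on [E = im L] is the hypothesis itself; on [F = ker L], an index [J] with
[B ^ J] close to [L] gives [|A ^ J x| >= 2 |x|], and an exponent [j] is divided
by [J] with remainder to get a growth rate [gamma] with [gamma ^ J <= 2]. *)
Lemma backward_bounded_expanding (A : 'M[R]_n.+1) :
  A \in unitmx -> 1 < `|\det A| -> backward_bounded A -> expanding_on_subspace A.
Proof.
move=> Au detA [K K0 HK]; pose B := A^-1.
have ABj j : A ^+ j *m B ^+ j = 1%:M.
  by rewrite -[LHS]/(_ * _) exprVn divrr// unitrX.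
have BAj j : B ^+ j *m A ^+ j = 1%:M.
  by rewrite -[LHS]/(_ * _) exprVn mulVr// unitrX.
have BK (j : nat) : `|B ^+ j| <= K * `|1%:M : 'M[R]_n.+1|.
  by rewrite -(ABj j); apply: norm_le_mulmx_columns (HK j); exact: ltW.
pose P d := `[< exists2 L, power_cluster B L &
  \dim (limg (linfun (mulmx L) : 'End(V))) = d >].
have exP : exists d, P d.
  have [L BL] := bounded_seq_cluster BK.
  by eexists; apply/asboolP; exists L.
have [d /asboolP[L BL rkL] dmin] := ex_minnP exP.
set f : 'End(V) := linfun (mulmx L) in rkL.
have [FE FIE] : (lker f + limg f = fullv)%VS /\ (lker f :&: limg f = 0)%VS.
  apply: stable_splitting; rewrite -/f rkL.
  apply/eqP; rewrite eqn_leq; apply/andP; split.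
    rewrite -rkL; apply: dimvS; apply/subvP => _ /memv_imgP[x _ ->].
    rewrite mulmx_linfunE -[_ * _]/(_ *m _) -mulmxA -mulmx_linfunE.
    by rewrite memv_img ?memvf.
  apply: dmin; apply/asboolP; exists (L * L) => //.
  exact: (power_cluster_mul BK BL BL).
have BL_comm : B * L = L * B := power_cluster_comm BL.
have AL_comm : A * L = L * A.
  have := congr1 (fun X => A * X * A) BL_comm.
  by rewrite /B !mulrA mulrV// mul1r -!mulrA mulVr// mulr1.
have Fker x : (x \in lker f) = (L *m x == 0) by rewrite memv_ker mulmx_linfunE.
have FA (C : 'M[R]_n.+1) x : C * L = L * C -> x \in lker f -> C *m x \in lker f.
  move=> CL; rewrite !Fker mulmxA -[L *m C]/(_ * _) -CL -mulmxA => /eqP ->.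
  by rewrite mulmx0.
have EA (C : 'M[R]_n.+1) x : C * L = L * C -> x \in limg f -> C *m x \in limg f.
  move=> CL /memv_imgP[y _ ->]; rewrite mulmx_linfunE mulmxA -[C *m L]/(_ * _) CL.
  by rewrite -mulmxA -mulmx_linfunE memv_img ?memvf.
have inv (U : {vspace V}) :
    (forall C x, C * L = L * C -> x \in U -> C *m x \in U) ->
    (linfun (mulmx A) @: U = U)%VS.
  move=> UC; apply/eqP; rewrite eqEsubv; apply/andP; split; apply/subvP => x.
    by move=> /memv_imgP[y yU ->]; rewrite mulmx_linfunE UC.
  move=> xU; apply/memv_imgP; exists (B *m x); first exact: UC.
  by rewrite mulmx_linfunE mulmxA -[A]expr1 -[B]expr1 ABj mul1mx.
have Bu : B \is a GRing.unit by rewrite unitrV.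
have detB : `|\det B| < 1.
  by rewrite det_inv normfV invf_lt1// (lt_trans ltr01).
(* With this precision, (B ^ J - L) has operator norm at most 1/2. *)
have [e e0 eN] : exists2 e, 0 < e & n.+1%:R * e = 2^-1 :> R.
  exists (n.+1%:R^-1 * 2^-1); first by rewrite mulr_gt0 ?invr_gt0.
  by rewrite mulrA divff ?mul1r// pnatr_eq0.
have [J J0 BJ] := BL _ 1%N e0.
have expJ x : x \in lker f -> 2 * `|x| <= `|A ^+ J *m x|.
  move=> xF; set y := A ^+ J *m x.
  have yF : L *m y = 0.
    by apply/eqP; rewrite -Fker /y; apply: mem_pow_invariant => //; exact: inv.
  have -> : x = (B ^+ J - L) *m y by rewrite mulmxBl yF subr0 mulmxA BAj mul1mx.
  rewrite mulrC -ler_pdivlMr// mulrC (le_trans (norm_mulmx_le _ _))//.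
  rewrite ler_wpM2r//.
  by rewrite -eN ler_wpM2l// ltW.
have expJq q x : x \in lker f -> 2 ^+ q * `|x| <= `|A ^+ (J * q) *m x|.
  move=> xF; elim: q => [|q IH]; first by rewrite muln0 !expr0 mul1r mul1mx.
  rewrite mulnS exprD -[_ * _ in X in _ <= X]/(_ *m _) -mulmxA exprS -mulrA.
  apply: le_trans (expJ _ _); first by rewrite ler_wpM2l.
  by apply: mem_pow_invariant => //; exact: inv.
exists (lker f).
  apply/eqP => F0; have /negP := power_cluster_singular Bu detB BL; apply.
  rewrite -unitmx_tr -row_free_unit -kermx_eq0; apply/rowV0P => v /sub_kermxP vL.
  have : v^T \in lker f by rewrite Fker -[L]trmxK -trmx_mul vL trmx0.
  by rewrite F0 memv0 => /eqP /(congr1 trmx); rewrite trmxK trmx0.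
exists (limg f); split=> //; first by split; apply: inv.
- have [gamma gamma1 gammaJ] := exists_root_below_two J0.
  exists (2 * n.+1%:R * K + 1), gamma; split=> // [|j x xF].
    by rewrite lerDr !mulr_ge0 ?ltW.
  pose q := (j %/ J)%N; pose s := (j %% J)%N.
  have jE : j = (s + J * q)%N by rewrite addnC mulnC -divn_eq.
  have gamma_j : gamma ^+ j <= 2 * 2 ^+ q.
    have gamma0 : 0 <= gamma by rewrite ltW// (lt_trans ltr01).
    rewrite jE exprD exprM ler_pM ?exprn_ge0//.
      by rewrite (le_trans _ gammaJ)// ler_weXn2l ?(ltW gamma1)// ltnW// ltn_mod.
    by rewrite lerXn2r ?nnegrE ?exprn_ge0.
  have growth : 2 ^+ q * `|x| <= K * enorm (A ^+ j *m x).
    apply: le_trans (expJq q x xF) _; apply: le_trans (HK s _) _.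
    rewrite mulmxA -[_ *m A ^+ (J * q)]/(_ * _) -exprD -jE.
    by rewrite ler_wpM2l ?(ltW K0)// norm_le_enorm.
  rewrite -mulrA ler_pdivrMl ?ltr_wpDl ?mulr_ge0 ?(ltW K0)//.
  have x_le : enorm x <= n.+1%:R * `|x| := enorm_le_norm x.
  apply: le_trans (ler_pM _ (enorm_ge0 x) gamma_j x_le) _.
    by rewrite exprn_ge0// ltW// (lt_trans ltr01).
  have -> : 2 * 2 ^+ q * (n.+1%:R * `|x|) = 2 * n.+1%:R * (2 ^+ q * `|x|) by ring.
  apply: le_trans (ler_wpM2l _ growth) _; first by rewrite mulr_ge0.
  by have := enorm_ge0 (A ^+ j *m x); nra.
- exists (n.+1%:R * K)^-1; first by rewrite invr_gt0 mulr_gt0.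
  move=> j x _; rewrite ler_pdivrMl ?mulr_gt0// (le_trans (enorm_le_norm _))//.
  rewrite -mulrA ler_wpM2l// (le_trans (HK j x))//.
  by rewrite ler_wpM2l ?(ltW K0)// norm_le_enorm.
Qed.
End Splitting.

Theorem theorem2p4 (R : realType) (n : nat) (A : 'M[R]_n.+1)
    (A_unit : A \in unitmx) (det_gt1 : 1 < `|\det A|) :
  (forall Gamma : set 'cV[R]_n.+1,
      full_rank_lattice Gamma -> lattice_counting_estimate A Gamma)
  <-> expanding_on_subspace A.
Proof.
split=> [LCE|A_expanding Gamma].
  apply: backward_bounded_expanding => //.
  exact: counting_backward_bounded.
apply: backward_bounded_counting => //.
exact: expanding_backward_bounded.
Qed.
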